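(* Let $\delta\in(0,1)$ and $d\geq 2$. If $g:\{0,1\}^N\to\{0,1\}$ is a Boolean function solving the $\delta$-coin problem, then any $\mathrm{AC}^0[\oplus]$ formula of depth $d$ computing $g$ must have size $\exp(\Omega(d(1/\delta)^{1/(d-1)}))$, where the $\Omega(\cdot)$ hides an absolute constant.
   Context: For $\alpha\in[0,1]$ and integer $N\geq 1$, $D_\alpha^N$ is the product distribution on $\{0,1\}^N$ in which each bit is independently $1$ with probability $\alpha$. Let $\mu_0^N=D^N_{(1-\delta)/2}$ and $\mu_1^N=D^N_{(1+\delta)/2}$. A function $g:\{0,1\}^N\to\{0,1\}$ solves the $\delta$-coin problem if $\Pr_{x\sim\mu_0^N}[g(x)=1]\leq 0.1$ and $\Pr_{x\sim\mu_1^N}[g(x)=1]\geq 0.9$. An $\mathrm{AC}^0[\oplus]$ formula of depth $d$ is a depth-$d$ Boolean formula with unbounded fan-in AND, OR, parity gates and NOT gates; its size is its total number of gates including input gates.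
   Formalization: As stated, one absolute constant for all d and δ fails (δ=0.9, g(x)=x, padded depth-d formula of size O(d)); proved for d ≤ C(1+ln(1/δ)) with a constant depending only on C, for formulas of depth at most d with at least two gates. *)

(* Defs.v *)
From mathcomp Require Import all_boot all_order all_algebra.
From mathcomp Require Import all_classical all_reals all_analysis.

Set Implicit Arguments.
Unset Strict Implicit.
Unset Printing Implicit Defensive.

Import Order.TTheory GRing.Theory Num.Theory.

Local Open Scope ring_scope.

Definition cube (N : nat) := {ffun 'I_N -> bool}.

Definition coin_weight (R : realType) (alpha : R) (N : nat) (x : cube N) : R :=
  \prod_(i < N) (if x i then alpha else 1 - alpha).

(* Pr_(x ~ D_alpha^N)[A x] *)
Definition coin_prob (R : realType) (alpha : R) (N : nat) (A : pred (cube N)) : R :=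
  \sum_(x : cube N | A x) coin_weight alpha x.

Definition solves_coin (R : realType) (delta : R) (N : nat)
    (g : cube N -> bool) : Prop :=
  coin_prob ((1 - delta) / 2) g <= 1 / 10 /\
  9 / 10 <= coin_prob ((1 + delta) / 2) g.

(* Gates of fan-in 0 are allowed: they give the two constants. *)
Inductive formula (N : nat) : Type :=
| FVar of 'I_N
| FNot of formula N
| FAnd of seq (formula N)
| FOr of seq (formula N)
| FXor of seq (formula N).

Fixpoint feval (N : nat) (F : formula N) (x : cube N) : bool :=
  match F with
  | FVar i => x i
  | FNot F1 => ~~ feval F1 x
  | FAnd Fs => all (fun F1 => feval F1 x) Fs
  | FOr Fs => has (fun F1 => feval F1 x) Fs
  | FXor Fs => foldr addb false (map (fun F1 => feval F1 x) Fs)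
  end.

Fixpoint fsize (N : nat) (F : formula N) : nat :=
  match F with
  | FVar _ => 1
  | FNot F1 => (fsize F1).+1
  | FAnd Fs | FOr Fs | FXor Fs => (sumn (map (@fsize N) Fs)).+1
  end.

(* NOT gates are free: the depth is the largest number of AND, OR and parity
   gates on a path from the output to an input. Charging NOT gates as well can
   only increase the depth of a given formula. *)
Fixpoint fdepth (N : nat) (F : formula N) : nat :=
  match F with
  | FVar _ => 0
  | FNot F1 => fdepth F1
  | FAnd Fs | FOr Fs | FXor Fs => (foldr maxn 0 (map (@fdepth N) Fs)).+1
  end.

Definition computes (N : nat) (F : formula N) (g : cube N -> bool) : Prop :=
  forall x : cube N, feval F x = g x.

(* Main.v *)
Require Import Defs.
From mathcomp Require Import all_boot all_order all_algebra.
From mathcomp Require Import all_classical all_reals all_analysis.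
From mathcomp Require Import fintype finset zify ring lra.
From mathcomp Require polyrcf.

Set Implicit Arguments.
Unset Strict Implicit.
Unset Printing Implicit Defensive.

Import Order.TTheory GRing.Theory Num.Theory.

Local Open Scope ring_scope.

(* Over F_2, a formula of size s and depth d agrees at every point, up to error
   1/8, with a random polynomial of degree O(1 + (ln s) / d)^(d-1): by
   Razborov's random parities a gate costs O(1) in degree once its inputs are
   accurate, and a subformula of size s' needs error about s'/s only, which
   O(1 + ln (s/s')) independent copies provide.

   Conversely a polynomial f of degree D cannot distinguish the two coins
   unless D >= c / delta. By the mean value theorem it suffices to bound the
   derivative of the acceptance probability in the bias; after a random
   restriction this is the sum of the level-one Fourier coefficients of a
   polynomial of degree D, and Smolensky's dimension argument, applied at each
   threshold of the Hamming weight and summed over the thresholds, bounds that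
   sum by O(D). *)

(** * Degree over F_2 *)

Section Degree.
Variable N : nat.
Implicit Types (x : cube N) (f g : cube N -> bool) (A B : {set 'I_N}).
Implicit Types (D k : nat).

Definition supp x : {set 'I_N} := [set i | x i].

Definition indicator A : cube N := [ffun i => i \in A].

Lemma supp_indicator A : supp (indicator A) = A.
Proof. by apply/setP=> i; rewrite inE ffunE. Qed.

Lemma indicator_supp x : indicator (supp x) = x.
Proof. by apply/ffunP=> i; rewrite ffunE inE. Qed.

Lemma supp_inj : injective supp.
Proof. exact: can_inj indicator_supp. Qed.

(** A multilinear polynomial over F_2, encoded as the set of its monomials; the monomial [A] is 1 at
    [x] exactly when [A \subset supp x]. *)
Definition poly_eval (c : {set {set 'I_N}}) x : bool :=
  \big[addb/false]_A ((A \in c) && (A \subset supp x)).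

Definition deg_le D f : Prop :=
  exists2 c : {set {set 'I_N}},
    (forall A, A \in c -> (#|A| <= D)%N) & f =1 poly_eval c.

Lemma deg_le_eq D f g : f =1 g -> deg_le D f -> deg_le D g.
Proof. by move=> fg [c cD fc]; exists c => // x; rewrite -fg fc. Qed.

Lemma deg_leW D E f : (D <= E)%N -> deg_le D f -> deg_le E f.
Proof. by move=> DE [c cD fc]; exists c => // A /cD /leq_trans; apply. Qed.

Lemma deg_le_monomial A : deg_le #|A| (fun x => A \subset supp x).
Proof.
exists [set A] => [B /set1P->//|x].
rewrite /poly_eval (bigD1 A) //= set11 big1 ?addbF // => B nBA.
by rewrite inE (negPf nBA).
Qed.

Lemma deg_le_false : deg_le 0 (fun=> false).
Proof.
by exists set0 => [A|x]; rewrite /poly_eval ?inE // big1 // => A; rewrite inE.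
Qed.

Lemma deg_le_const (b : bool) : deg_le 0 (fun=> b).
Proof.
case: b; last exact: deg_le_false.
have := deg_le_monomial set0; rewrite cards0; apply: deg_le_eq => x.
exact: sub0set.
Qed.

Lemma deg_le_var (i : 'I_N) : deg_le 1 (fun x => x i).
Proof.
have := deg_le_monomial [set i]; rewrite cards1; apply: deg_le_eq => x.
by rewrite sub1set inE.
Qed.

Lemma deg_le_addb D f g :
  deg_le D f -> deg_le D g -> deg_le D (fun x => f x (+) g x).
Proof.
move=> [c cD fc] [e eD ge]; exists [set A | (A \in c) (+) (A \in e)].
  move=> A; rewrite inE.
  by case Ac: (A \in c); [rewrite cD | move=> /= Ae; rewrite eD].
move=> x; rewrite fc ge /poly_eval -big_split; apply: eq_bigr => A _ /=.
by rewrite inE andb_addl.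
Qed.

Lemma deg_le_negb D f : deg_le D f -> deg_le D (fun x => ~~ f x).
Proof.
by move=> df; apply: deg_le_addb (deg_leW (leq0n D) (deg_le_const true)) df.
Qed.

Lemma deg_le_big_addb D (I : Type) (r : seq I) (P : pred I)
    (f : I -> cube N -> bool) :
  (forall i, P i -> deg_le D (f i)) ->
  deg_le D (fun x => \big[addb/false]_(i <- r | P i) f i x).
Proof.
move=> df; elim: r => [|i r IH].
  apply: deg_le_eq (deg_leW (leq0n D) deg_le_false) => x.
  by rewrite big_nil.
case Pi: (P i).
  apply: deg_le_eq (deg_le_addb (df i Pi) IH) => x.
  by rewrite big_cons Pi.
by apply: deg_le_eq IH => x; rewrite big_cons Pi.
Qed.

(** Since a bit equals its square, monomials multiply to the monomial of their union; the sum over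
    pairs lets coinciding unions cancel by itself. *)
Lemma deg_le_andb D E f g :
  deg_le D f -> deg_le E g -> deg_le (D + E) (fun x => f x && g x).
Proof.
move=> [c cD fc] [e eE ge].
pose m A B x := (A :|: B) \subset supp x.
have dm : deg_le (D + E) (fun x =>
    \big[addb/false]_(A in c) \big[addb/false]_(B in e) m A B x).
  apply: deg_le_big_addb => A Ac; apply: deg_le_big_addb => B Be.
  apply: deg_leW (deg_le_monomial _).
  by rewrite (leq_trans (leq_card_setU A B)) // leq_add ?cD ?eE.
apply: deg_le_eq dm => x; rewrite fc ge /poly_eval big_distrlr /=.
rewrite big_mkcond; apply: eq_bigr => A _.
case: (A \in c) => /=; last by rewrite big1 //.
rewrite big_mkcond; apply: eq_bigr => B _; rewrite /m subUset.
by case: (B \in e); rewrite //= andbF.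
Qed.

Lemma deg_le_comp D f (s : 'I_N -> cube N -> bool) :
  (forall i, deg_le 1 (s i)) -> deg_le D f ->
  deg_le D (fun x => f [ffun i => s i x]).
Proof.
move=> ds [c cD fc].
have dall (r : seq 'I_N) : deg_le (size r) (fun x => all (s^~ x) r).
  elim: r => [|i r IH]; first exact: deg_le_const true.
  exact: deg_le_andb (ds i) IH.
have dA : deg_le D (fun x =>
    \big[addb/false]_(A in c) all (s^~ x) (enum A)).
  by apply: deg_le_big_addb => A /cD; rewrite cardE => /deg_leW; apply.
apply: deg_le_eq dA => x; rewrite fc /poly_eval big_mkcond.
apply: eq_bigr => A _; case: (A \in c) => //=.
apply/allP/subsetP => [h i iA|h i].
  by rewrite inE ffunE h // mem_enum.
by rewrite mem_enum => /h; rewrite inE ffunE.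
Qed.

(** Correct one slice at a time: a monomial of size [k.+1] vanishes on the lower slices, and on its
    own slice is 1 only at its own support. *)
Lemma low_weight_interpolation k (h : cube N -> bool) :
  exists2 f, deg_le k f & forall x, (#|supp x| <= k)%N -> f x = h x.
Proof.
elim: k => [|k [f df fh]].
  exists (fun=> h (indicator set0)); first exact: deg_le_const.
  move=> x; rewrite leqn0 cards_eq0 => /eqP x0.
  by rewrite -x0 indicator_supp.
pose g x := \big[addb/false]_(A : {set 'I_N} |
  (#|A| == k.+1) && (h (indicator A) != f (indicator A))) (A \subset supp x).
exists (fun x => f x (+) g x).
  apply: deg_le_addb (deg_leW (leqnSn k) df) _.
  apply: deg_le_big_addb => A /andP[/eqP <- _]; exact: deg_le_monomial.
move=> x; rewrite leq_eqVlt ltnS => /orP[/eqP xk|xk].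
  have -> : g x = (h x != f x).
    rewrite /g -{2 3}(indicator_supp x) big_mkcond (bigD1 (supp x)) //=.
    rewrite xk eqxx subxx /= big1 ?addbF => [|A nA]; first by case: ifP.
    case: ifP => // /andP[/eqP Ak _]; apply/negbTE/negP => sA.
    by case/eqP: nA; apply/eqP; rewrite eqEcard sA xk Ak leqnn.
  by case: (h x); case: (f x).
rewrite fh // /g big1 ?addbF // => A /andP[/eqP Ak _].
by apply/negbTE/negP => /subset_leq_card; rewrite Ak leqNgt ltnS xk.
Qed.

Lemma card_cube_supp (P : pred {set 'I_N}) :
  #|[set x : cube N | P (supp x)]| = #|[set A | P A]|.
Proof.
rewrite -(card_imset _ supp_inj); apply: eq_card => A; rewrite !inE.
apply/imsetP/idP => [[x]|PA]; first by rewrite inE => Px ->.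
by exists (indicator A); rewrite ?inE supp_indicator.
Qed.

Lemma supp_neg x : supp [ffun i => ~~ x i] = ~: supp x.
Proof. by apply/setP=> i; rewrite !inE ffunE. Qed.

(* Smolensky's dimension argument, as a count: [f] separates the low slices
   from the high ones on the set [Z] of points listed below, so every function
   on [Z] is [if f then p else q] with [p] and [q] of degree at most [k]. *)
Lemma low_degree_separation D k f : deg_le D f -> (k.*2 < N)%N ->
  (#|[set x | (#|supp x| <= k) && ~~ f x || (N - k <= #|supp x|) && f x]|
   <= #|[set x : cube N | #|supp x| <= k + D]|)%N.
Proof.
move=> df kN; set Z := [set x | _].
rewrite (card_cube_supp (fun A => (#|A| <= k + D)%N)).
set M := [set A : {set 'I_N} | _].
(* Compare powers of 2: every subset [B] of [Z] is cut out by a polynomial with monomials in [M], so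
   [F] maps the subsets of [M] onto those of [Z]. *)
rewrite -(leq_exp2l _ _ (isT : (1 < 2)%N)) -!card_powerset.
pose F (c : {set {set 'I_N}}) := Z :&: [set x | poly_eval c x].
apply: leq_trans (leq_imset_card F _); apply: subset_leq_card.
apply/subsetP => B; rewrite inE => BZ.
have [q dq qB] := low_weight_interpolation k (fun x => x \in B).
(* Negating all bits carries the high slices to the low ones. *)
have [p dp pB] := low_weight_interpolation k
  (fun x => [ffun i => ~~ x i] \in B).
pose p' x := p [ffun i => ~~ x i].
have dp' : deg_le k p'.
  by apply: deg_le_comp dp => i; apply: deg_le_negb; exact: deg_le_var.
have : deg_le (k + D) (fun x => (p' x && f x) (+) (q x && ~~ f x)).
  by apply: deg_le_addb; apply: deg_le_andb => //; exact: deg_le_negb.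
move=> [c cD fc]; apply/imsetP; exists c.
  by rewrite inE; apply/subsetP => A /cD; rewrite inE.
apply/setP => x; rewrite /F in_setI [x \in [set _ | _]]inE -fc.
have [xZ|xZ] := boolP (x \in Z); last first.
  by apply/negbTE/negP => /(subsetP BZ); rewrite (negPf xZ).
move: xZ; rewrite inE /=; case fx: (f x); rewrite ?andbF ?andbT ?orbF /=.
  move=> xN; rewrite addbF /p' pB.
    by congr (_ \in B); apply/ffunP => i; rewrite !ffunE negbK.
  by rewrite supp_neg cardsCs setCK card_ord leq_subCl.
by move=> xk; rewrite qB.
Qed.

End Degree.

(** * Low degree polynomials under a biased coin *)

Section Bias.
Variables (R : realType) (N : nat).
Implicit Types (x z : cube N) (f : cube N -> bool) (D k : nat).

Lemma card_sum_indicator (P : pred (cube N)) :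
  #|[set x | P x]|%:R = \sum_x (P x)%:R :> R.
Proof.
rewrite -sum1_card natr_sum big_mkcond; apply: eq_bigr => x _.
by rewrite inE; case: (P x).
Qed.

(** * Slices of the Hamming weight *)

Let low k x := (#|supp x| <= k)%N.
Let high k x := (N - k <= #|supp x|)%N.
Let slab D k x := (k < #|supp x| <= k + D)%N.

Let contrast f k : R := \sum_x (f x)%:R * ((high k x)%:R - (low k x)%:R).

(** Taking the size of the low slices off both sides of the dimension count leaves [contrast] and
    the slab; [k.*2 < N] keeps low and high slices disjoint. *)
Let contrast_le_slab D k f : deg_le D f -> (k.*2 < N)%N ->
  contrast f k <= \sum_x (slab D k x)%:R.
Proof.
move=> df kN; have := low_degree_separation df kN.
rewrite -(ler_nat R) !card_sum_indicator -subr_ge0 -sumrB => h.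
rewrite -subr_ge0 /contrast -sumrB.
rewrite (le_trans h) // le_eqVlt; apply/orP; left; apply/eqP.
apply: eq_bigr => x _; rewrite /low /high /slab.
have [xk|xk] := leqP #|supp x| k.
  rewrite (leq_trans xk (leq_addr _ _)).
  have -> : (N - k <= #|supp x|)%N = false.
    apply/negbTE; rewrite -ltnNge ltn_subRL.
    by rewrite (leq_ltn_trans _ kN) // -addnn leq_add2l.
  by case: (f x) => /=; ring.
by case: (N - k <= _)%N; case: (f x); case: (_ <= k + D)%N => /=; ring.
Qed.

Let contrast_rev f (k : 'I_N) : contrast f (rev_ord k) = contrast f k.
Proof.
apply: eq_bigr => x _; congr (_ * _).
have -> : high (rev_ord k) x = ~~ low k x.
  by rewrite /high /low /= -ltnNge; have := ltn_ord k; lia.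
have -> : high k x = ~~ low (rev_ord k) x.
  by rewrite /high /low /= -ltnNge; have := ltn_ord k; lia.
by case: low; case: low => /=; ring.
Qed.

Let sum_low n w : (\sum_(k < n) (w <= k) = n - w)%N.
Proof.
elim: n => [|n IH]; rewrite ?big_ord0 ?sub0n // big_ord_recr /= IH.
by case: leqP; lia.
Qed.

Let sum_high n w : (w <= n)%N -> (\sum_(k < n) (n - k <= w) = w)%N.
Proof.
move=> wn; rewrite (reindex_inj rev_ord_inj) /=.
have -> : (\sum_(k < n) (n - (n - k.+1) <= w) = \sum_(k < n) (k < w))%N.
  by apply: eq_bigr => k _; rewrite subKn.
suff -> : (\sum_(k < n) (k < w) = minn n w)%N by lia.
elim: n {wn} => [|n IH]; rewrite ?big_ord0 ?min0n // big_ord_recr /= IH.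
by case: ltnP; lia.
Qed.

Let sum_slab n w D : (\sum_(k < n) (k < w <= k + D) <= D)%N.
Proof.
suff : (\sum_(k < n) (k < w <= k + D) = minn n w - minn n (w - D))%N by lia.
elim: n => [|n IH]; rewrite ?big_ord0 ?min0n // big_ord_recr /= IH.
by case: ltnP; case: leqP; lia.
Qed.

(* Sum the previous bound over [k], using
   2 #|supp x| - N = sum_k (high k x - low k x). *)
Lemma low_degree_first_moment D f : deg_le D f ->
  \sum_x (f x)%:R * (2 * #|supp x|%:R - N%:R) <= 2 * D%:R * 2 ^+ N :> R.
Proof.
move=> df.
have wN x : (#|supp x| <= N)%N by rewrite -[leqRHS]card_ord max_card.
have -> : \sum_x (f x)%:R * (2 * #|supp x|%:R - N%:R) =
    \sum_(k < N) contrast f k :> R.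
  rewrite exchange_big; apply: eq_bigr => x _ /=.
  rewrite -mulr_sumr sumrB -!natr_sum /high /low sum_high // sum_low.
  by rewrite natrB //; congr (_ * _); ring.
have slab_ge0 k : 0 <= \sum_x (slab D k x)%:R :> R.
  by apply: sumr_ge0 => x _; exact: ler0n.
(* Either [k] or its mirror image lies below the middle; bounding by both slabs avoids splitting the
   sum and costs a factor 2. *)
have contr (k : 'I_N) : contrast f k <=
    \sum_x (slab D k x)%:R + \sum_x (slab D (rev_ord k) x)%:R.
  have [kN|kN] := ltnP k.*2 N.
    by apply: le_trans (contrast_le_slab df kN) _; rewrite lerDl.
  rewrite -contrast_rev.
  apply: le_trans (contrast_le_slab (k := rev_ord k) df _) _.
    by have := ltn_ord k; rewrite /=; lia.
  by rewrite lerDr.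
apply: le_trans; first by apply: ler_sum => k _; exact: contr.
have slabs : \sum_(k < N) \sum_x (slab D k x)%:R <= D%:R * 2 ^+ N :> R.
  rewrite exchange_big /=.
  have -> : D%:R * 2 ^+ N = \sum_(x : cube N) D%:R :> R.
    by rewrite sumr_const card_ffun card_bool card_ord -[RHS]mulr_natr natrX.
  by apply: ler_sum => x _; rewrite -natr_sum ler_nat; exact: sum_slab.
have slabs' : \sum_(k < N) \sum_x (slab D (rev_ord k) x)%:R
    <= D%:R * 2 ^+ N :> R.
  rewrite (reindex_inj rev_ord_inj).
  by under eq_bigr do rewrite rev_ordK.
by rewrite big_split; apply: le_trans (lerD slabs slabs') _; lra.
Qed.

Lemma deriv_prod (I : eqType) (r : seq I) (F : I -> {poly R}) : uniq r ->
  (\prod_(i <- r) F i)^`() =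
  \sum_(i <- r) (F i)^`() * \prod_(j <- r | j != i) F j.
Proof.
elim: r => [|a r IH] /=; first by rewrite !big_nil derivC.
case/andP=> ar ur; rewrite !big_cons derivM IH // eqxx; congr (_ * _ + _).
  rewrite [RHS]big_seq_cond [LHS]big_seq; apply: eq_bigl => i.
  by case ir: (i \in r) => //=; apply/esym; apply: contraNneq ar => <-.
rewrite mulr_sumr; apply: eq_big_seq => i ir; rewrite big_cons.
by rewrite ifT; [rewrite mulrCA | apply: contraNneq ar => ->].
Qed.

(** * Random restrictions and the derivative in the bias *)

Let sgn (b : bool) : R := if b then 1 else - 1.

Let sum_sgn x : \sum_i sgn (x i) = 2 * #|supp x|%:R - N%:R.
Proof.
have -> : \sum_i sgn (x i) = \sum_i ((x i)%:R * 2 - 1).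
  by apply: eq_bigr => i _; rewrite /sgn; case: (x i); rewrite /=; ring.
rewrite sumrB -mulr_suml sumr_const card_ord mulrC; congr (_ * _ - _).
rewrite -sum1_card natr_sum [RHS]big_mkcond; apply: eq_bigr => i _.
by rewrite inE; case: (x i).
Qed.

Let restrict (r : option bool) (b : bool) : bool := odflt b r.

Section Restriction.
Variables (delta beta : R).
Hypotheses (beta_ge0 : 0 <= beta) (beta_le : beta <= delta).
Hypothesis delta_le1 : delta <= 1.

Let rweight (r : option bool) : R :=
  match r with None => 1 - delta | Some true => beta | _ => delta - beta end.

Let cweight (b : bool) : R :=
  if b then (1 - delta) / 2 + beta else (1 + delta) / 2 - beta.

(** The chance that the bit [b] becomes [b'] under a random restriction; its mean over a uniform [b]
    is [cweight b']. *)
Let kernel (b b' : bool) : R :=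
  (if b == b' then 1 - delta else 0) + (if b' then beta else delta - beta).

Let sum_option_bool (F : option bool -> R) :
  \sum_r F r = F None + F (Some true) + F (Some false).
Proof.
rewrite (bigD1 None) //= (bigD1 (Some true)) //= (bigD1 (Some false)) //=.
by rewrite big1 ?addr0 ?addrA // => -[[]|].
Qed.

Let sum_bool (F : bool -> R) : \sum_b F b = F true + F false.
Proof. by rewrite (bigD1 true) //= (bigD1 false) //= big1 ?addr0 // => -[]. Qed.

Let kernelE b b' : kernel b b' = \sum_r rweight r * (restrict r b == b')%:R.
Proof.
rewrite sum_option_bool /kernel /restrict /=.
by case: b; case: b' => /=; ring.
Qed.

(** Expanding the product of the kernels gives a sum over whole restrictions [r], in which only the
    restricted image of [z] survives. *)
Let kernel_average f z :
  \sum_x (f x)%:R * \prod_i kernel (z i) (x i) =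
  \sum_(r : {ffun 'I_N -> option bool})
    (\prod_i rweight (r i)) * (f [ffun i => restrict (r i) (z i)])%:R.
Proof.
under eq_bigr => x _.
  under eq_bigr do rewrite kernelE.
  rewrite bigA_distr_bigA /= mulr_sumr.
  over.
rewrite exchange_big /=; apply: eq_bigr => r _.
rewrite (bigD1 [ffun i => restrict (r i) (z i)]) //= [X in _ + X]big1 ?addr0.
  rewrite mulrC; congr (_ * _); apply: eq_bigr => i _.
  by rewrite ffunE eqxx mulr1.
move=> x nx; rewrite big_split /=.
have [i ni] : exists i, restrict (r i) (z i) != x i.
  apply/existsP; apply: contra_neqT nx => /existsPn h.
  by apply/ffunP => i; rewrite ffunE; have := h i; rewrite negbK => /eqP.
by rewrite [X in _ * (_ * X)](bigD1 i) //= (negPf ni) mul0r !mulr0.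
Qed.

(* Restrict each coordinate at random: it stays free with probability
   [1 - delta] and is otherwise fixed so that the bias comes out right. *)
Lemma low_degree_biased_moment D f : deg_le D f ->
  (1 - delta) *
  \sum_(x : cube N) (f x)%:R *
    \sum_i sgn (x i) * \prod_(j | j != i) cweight (x j)
  <= 4 * D%:R.
Proof.
move=> df.
have rw_ge0 r : 0 <= rweight r by case: r => [[]|]; rewrite /= ?subr_ge0.
have rw_sum : \sum_(r : {ffun 'I_N -> option bool}) \prod_i rweight (r i) = 1.
  rewrite -(bigA_distr_bigA (fun=> rweight)) /= big1 // => i _.
  by rewrite sum_option_bool /=; ring.
(* Each restricted [f] still has degree at most [D], so the uniform bound holds for it and survives
   averaging over [r]. *)
have up : \sum_(z : cube N) (\sum_x (f x)%:R * \prod_i kernel (z i) (x i)) *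
    (2 * #|supp z|%:R - N%:R) <= 2 * D%:R * 2 ^+ N.
  under eq_bigr do rewrite kernel_average mulr_suml.
  rewrite exchange_big /= -[leRHS]mul1r -[X in _ <= X * _]rw_sum mulr_suml.
  apply: ler_sum => r _; under eq_bigr do rewrite -mulrA.
  rewrite -mulr_sumr ler_wpM2l ?prodr_ge0 //.
  apply: low_degree_first_moment
    (fun z => f [ffun i => restrict (r i) (z i)]) _.
  apply: deg_le_comp df => i; case: (r i) => [b|] /=; last exact: deg_le_var.
  exact: deg_leW (deg_le_const _ b).
have E : \sum_(z : cube N) (\sum_x (f x)%:R * \prod_i kernel (z i) (x i)) *
    (2 * #|supp z|%:R - N%:R) * 2 = 2 ^+ N * ((1 - delta) *
  \sum_(x : cube N) (f x)%:R *
    \sum_i sgn (x i) * \prod_(j | j != i) cweight (x j)).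
  under eq_bigr do rewrite -sum_sgn 2!mulr_suml.
  rewrite exchange_big !mulr_sumr; apply: eq_bigr => x _ /=.
  under eq_bigr do rewrite -!mulrA.
  rewrite -mulr_sumr [in RHS]mulrCA [in RHS]mulrA [in RHS]mulrCA -mulrA.
  congr (_ * _).
  (* With [sgn] absorbed into coordinate [i], the sum over [z] factorises. At [i] the fixed part of
     the kernel cancels; the extra 2 there completes the [N.-1] other factors 2 to [2 ^+ N]. *)
  pose h i j b := kernel b (x j) * (if j == i then 2 * sgn b else 1).
  have hE (z : cube N) : \prod_j kernel (z j) (x j) *
      ((\sum_i sgn (z i)) * 2) = \sum_i \prod_j h i j (z j).
    rewrite mulr_suml mulr_sumr; apply: eq_bigr => i _.
    rewrite /h big_split /=; congr (_ * _).
    by rewrite -big_mkcond /= big_pred1_eq mulrC.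
  rewrite (eq_bigr _ (fun z _ => hE z)).
  rewrite exchange_big !mulr_sumr /=; apply: eq_bigr => i _.
  rewrite -bigA_distr_bigA /= (bigD1 i) //=.
  have -> : \sum_b h i i b = 2 * ((1 - delta) * sgn (x i)).
    rewrite sum_bool /h eqxx /kernel /sgn.
    by case: (x i) => /=; ring.
  have -> : \prod_(j | j != i) \sum_b h i j b =
      \prod_(j | j != i) (2 * cweight (x j)).
    apply: eq_bigr => j /negPf ji; rewrite sum_bool /h ji /kernel /cweight.
    by case: (x j) => /=; field.
  rewrite big_split /= prodr_const cardC1 card_ord.
  have -> : 2 ^+ N = 2 * 2 ^+ N.-1 :> R.
    by rewrite -exprS prednK // (leq_trans _ (ltn_ord i)).
  by ring.
have : 2 ^+ N * ((1 - delta) * \sum_(x : cube N) (f x)%:R *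
    \sum_i sgn (x i) * \prod_(j | j != i) cweight (x j)) <=
    2 ^+ N * (4 * D%:R) by rewrite -E -mulr_suml; lra.
by rewrite ler_pM2l // exprn_gt0.
Qed.

End Restriction.

(** The acceptance probability is a polynomial [G] in the shift of the bias. By the mean value
    theorem the gap is [delta] times a value of its derivative, which by the product rule is the
    biased moment. *)
Lemma low_degree_coin_gap D f (delta : R) :
  0 < delta -> delta < 1 -> deg_le D f ->
  \sum_x (coin_weight ((1 + delta) / 2) x - coin_weight ((1 - delta) / 2) x)
    * (f x)%:R <= 4 * D%:R * delta / (1 - delta).
Proof.
move=> d0 d1 df.
pose fac (b : bool) : {poly R} :=
  if b then ((1 - delta) / 2)%:P + 'X else ((1 + delta) / 2)%:P - 'X.
pose G : {poly R} := \sum_(x : cube N) (f x)%:R *: \prod_i fac (x i).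
have GE b : G.[b] =
    \sum_(x : cube N) (f x)%:R * coin_weight ((1 - delta) / 2 + b) x.
  rewrite /G horner_sum; apply: eq_bigr => x _.
  rewrite hornerZ horner_prod; congr (_ * _); apply: eq_bigr => i _.
  by rewrite /fac; case: (x i); rewrite !hornerE //; field.
have [b /andP[b0 b1]] := polyrcf.poly_mvt G d0.
rewrite !GE addr0 subr0 -sumrB => e.
have -> : \sum_x (coin_weight ((1 + delta) / 2) x -
    coin_weight ((1 - delta) / 2) x) * (f x)%:R = G^`().[b] * delta.
  rewrite -e; apply: eq_bigr => x _.
  have -> : (1 - delta) / 2 + delta = (1 + delta) / 2 by field.
  by ring.
have := low_degree_biased_moment (ltW b0) (ltW b1) (ltW d1) df.
set S := \sum_x _; have -> : S = G^`().[b].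
  rewrite /G raddf_sum horner_sum; apply: eq_bigr => x _.
  rewrite /= derivZ hornerZ deriv_prod ?index_enum_uniq // horner_sum.
  congr (_ * _); apply: eq_bigr => i _.
  rewrite hornerM horner_prod; congr (_ * _).
    rewrite /fac /sgn; case: (x i).
      by rewrite derivD derivC derivX add0r hornerC.
    by rewrite derivB derivC derivX sub0r hornerN hornerC.
  apply: eq_bigr => j _.
  by rewrite /fac; case: (x j); rewrite !hornerE.
move=> h; rewrite [leRHS]mulrAC ler_wpM2r ?(ltW d0) //.
by rewrite ler_pdivlMr ?subr_gt0 // mulrC.
Qed.

End Bias.

(** * Random polynomials *)

Section Hull.
Variables (R : realType) (N : nat).
Implicit Types (x : cube N) (f g h : cube N -> bool) (p q : cube N -> R).
Implicit Types (D E : nat).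

(* The convex hull of the Boolean functions of degree at most [D], described
   through its supporting half-spaces: [p x] is the probability that a random
   polynomial takes the value 1 at [x]. *)
Definition hull D p : Prop := forall (c : cube N -> R) (B : R),
  (forall f, deg_le D f -> \sum_x c x * (f x)%:R <= B) ->
  \sum_x c x * p x <= B.

Lemma hull_eq D p q : p =1 q -> hull D p -> hull D q.
Proof.
by move=> pq hp c B /hp; under eq_bigr do rewrite pq.
Qed.

Lemma deg_le_hull D f : deg_le D f -> hull D (fun x => (f x)%:R).
Proof. by move=> df c B; apply. Qed.

Lemma hullW D E p : (D <= E)%N -> hull D p -> hull E p.
Proof. by move=> DE hp c B cB; apply: hp => f /(deg_leW DE)/cB. Qed.

(** An affine map pulls half-spaces back to half-spaces, so it suffices to treat Boolean functions.
    Operations on several hull points are handled one argument at a time. *)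
Lemma hull_affine D E p (u v : cube N -> R) : hull D p ->
  (forall f, deg_le D f -> hull E (fun x => u x * (f x)%:R + v x)) ->
  hull E (fun x => u x * p x + v x).
Proof.
move=> hp hf c B cB.
have aff q : \sum_x c x * (u x * q x + v x) =
    \sum_x (c x * u x) * q x + \sum_x c x * v x.
  by rewrite -big_split; apply: eq_bigr => x _ /=; ring.
rewrite aff -lerBrDr; apply: hp => f df.
by rewrite lerBrDr -aff; exact: hf.
Qed.

Lemma hull_mean D p q :
  hull D p -> hull D q -> hull D (fun x => (p x + q x) / 2).
Proof.
move=> hp hq c B cB; have := hp c B cB; have := hq c B cB.
have -> : \sum_x c x * ((p x + q x) / 2) =
    (\sum_x c x * p x + \sum_x c x * q x) / 2.
  by rewrite -big_split mulr_suml; apply: eq_bigr => x _ /=; field.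
lra.
Qed.

Lemma hull_neg D p : hull D p -> hull D (fun x => 1 - p x).
Proof.
move=> hp; suff: hull D (fun x => -1 * p x + 1).
  by apply: hull_eq => x; ring.
apply: hull_affine hp _ => f /deg_le_negb/deg_le_hull.
by apply: hull_eq => x; case: (f x) => /=; ring.
Qed.

Lemma hull_xor D p q : hull D p -> hull D q ->
  hull D (fun x => p x + q x - 2 * p x * q x).
Proof.
move=> hp hq; suff: hull D (fun x => (1 - 2 * q x) * p x + q x).
  by apply: hull_eq => x; ring.
apply: hull_affine hp _ => f df.
suff: hull D (fun x => (1 - 2 * (f x)%:R) * q x + (f x)%:R).
  by apply: hull_eq => x; ring.
apply: hull_affine hq _ => g dg; have := deg_le_hull (deg_le_addb df dg).
by apply: hull_eq => x; case: (f x); case: (g x) => /=; ring.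
Qed.

(** An independent choice between [q] and [r] steered by [p]; on Boolean functions it is f g + (1 +
    f) h over F_2. *)
Lemma hull_mux D E p q r : hull D p -> hull E q -> hull E r ->
  hull (D + E) (fun x => p x * q x + (1 - p x) * r x).
Proof.
move=> hp hq hr; suff: hull (D + E) (fun x => (q x - r x) * p x + r x).
  by apply: hull_eq => x; ring.
apply: hull_affine hp _ => f df.
suff: hull (D + E) (fun x => (f x)%:R * q x + (1 - (f x)%:R) * r x).
  by apply: hull_eq => x; ring.
apply: hull_affine hq _ => g dg.
suff: hull (D + E) (fun x => (1 - (f x)%:R) * r x + (f x)%:R * (g x)%:R).
  by apply: hull_eq => x; ring.
apply: hull_affine hr _ => h dh.
have := deg_le_hull (deg_le_addb (deg_le_andb df dg)
  (deg_le_andb (deg_le_negb df) dh)).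
by apply: hull_eq => x; case: (f x); case: (g x); case: (h x) => /=; ring.
Qed.

Lemma hull_const D (b : bool) : hull D (fun=> b%:R).
Proof. exact: deg_le_hull (deg_leW (leq0n D) (deg_le_const _ b)). Qed.

Lemma hull_and D E p q :
  hull D p -> hull E q -> hull (D + E) (fun x => p x * q x).
Proof.
move=> hp hq; have := hull_mux hp hq (hull_const false).
by apply: hull_eq => x; rewrite mulr0 addr0.
Qed.

Lemma hull_le1 D p x : hull D p -> p x <= 1.
Proof.
have e q : \sum_y (y == x)%:R * q y = q x.
  rewrite (bigD1 x) //= eqxx mul1r big1 ?addr0 // => y /negPf->.
  by rewrite mul0r.
move=> hp; rewrite -e; apply: hp => f _; rewrite e.
by case: (f x); rewrite ?ler01.
Qed.

Lemma hull_ge0 D p x : hull D p -> 0 <= p x.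
Proof. by move=> /hull_neg /(hull_le1 x); lra. Qed.

(** The probability of at least [j] successes in [k] independent trials of probability [p], by
    conditioning on one trial. *)
Fixpoint threshold_prob (p : R) k j : R :=
  match j, k with
  | 0, _ => 1
  | _.+1, 0 => 0
  | j'.+1, k'.+1 =>
      p * threshold_prob p k' j' + (1 - p) * threshold_prob p k' j
  end.

Lemma hull_threshold D p k j :
  hull D p -> hull (k * D) (fun x => threshold_prob (p x) k j).
Proof.
move=> hp; elim: k j => [|k IH] [|j] /=; try exact: hull_const true.
  exact: hull_const false.
by rewrite mulSn; apply: hull_mux.
Qed.

Lemma threshold_prob_itv (p : R) k j :
  0 <= p <= 1 -> 0 <= threshold_prob p k j <= 1.
Proof.
case/andP=> p0 p1; elim: k j => [|k IH] [|j] /=; rewrite ?lexx ?ler01 //.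
have /andP[? ?] := IH j; have /andP[? ?] := IH j.+1.
by apply/andP; split; nra.
Qed.

(** A union bound over the at most [2 ^+ k] choices of [j] successful trials. *)
Lemma threshold_prob_low (p e : R) k j : 0 <= p <= 1 -> p <= e ->
  threshold_prob p k j <= 2 ^+ k * e ^+ j.
Proof.
move=> p01 pe; have /andP[p0 p1] := p01; have e0 : 0 <= e by apply: le_trans pe.
elim: k j => [|k IH] [|j] /=.
- by rewrite mulr1.
- by rewrite mul1r exprn_ge0.
- by rewrite mulr1 exprn_ege1 // ler1n.
have /andP[? ?] := threshold_prob_itv k j p01.
have /andP[? ?] := threshold_prob_itv k j.+1 p01.
have := IH j; have := IH j.+1; rewrite !exprS.
have : 0 <= 2 ^+ k * e ^+ j by rewrite mulr_ge0 ?exprn_ge0.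
set A := 2 ^+ k; set B := e ^+ j => AB0 h1 h2.
have : p * threshold_prob p k j <= e * (A * B) by apply: ler_pM.
nra.
Qed.

(** Dually, fewer than [j] successes force [k.+1 - j] failures; [j <= k.+1] keeps the truncated
    subtraction exact. *)
Lemma threshold_prob_high (p e : R) k j : 0 <= p <= 1 -> 1 - p <= e ->
  (j <= k.+1)%N -> 1 - threshold_prob p k j <= 2 ^+ k * e ^+ (k.+1 - j).
Proof.
move=> p01 pe; have /andP[p0 p1] := p01.
have e0 : 0 <= e by apply: le_trans pe; rewrite subr_ge0.
have A1 k' : 1 <= 2 ^+ k' :> R by rewrite exprn_ege1 // ler1n.
elim: k j => [|k IH] [|j] jk /=.
- by rewrite subrr mulr_ge0 ?exprn_ge0.
- by rewrite subr0 mul1r; case: j jk.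
- by rewrite subrr mulr_ge0 ?exprn_ge0.
have /andP[? ?] := threshold_prob_itv k j p01.
have /andP[? ?] := threshold_prob_itv k j.+1 p01.
move: jk; rewrite !ltnS leq_eqVlt subSS => /orP[/eqP->|jk].
  have /andP[] := threshold_prob_itv k.+1 k.+2 p01; rewrite subnn mulr1 /=.
  by have := A1 k.+1; lra.
have := IH j (ltnW jk); have := IH j.+1 jk; rewrite subSS.
have -> : (k.+1 - j = (k - j).+1)%N by rewrite subSn.
have : 0 <= 2 ^+ k * e ^+ (k - j) by rewrite mulr_ge0 ?exprn_ge0.
rewrite !exprS; set A := 2 ^+ k; set B := e ^+ _ => AB0 h1 h2.
have : (1 - p) * (1 - threshold_prob p k j.+1) <= e * (A * B).
  by apply: ler_pM; rewrite ?subr_ge0.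
nra.
Qed.

(** For a random polynomial with mean [p], the quantity bounded is its probability of differing from
    [f] at [x]. *)
Definition poly_approx D (e : R) f : Prop :=
  exists2 p, hull D p & forall x, `|p x - (f x)%:R| <= e.

Lemma approxW D E (e e' : R) f :
  (D <= E)%N -> e <= e' -> poly_approx D e f -> poly_approx E e' f.
Proof.
move=> DE ee [p hp pe]; exists p; first exact: hullW hp.
by move=> x; apply: le_trans ee.
Qed.

Lemma approx_eq D (e : R) f g :
  f =1 g -> poly_approx D e f -> poly_approx D e g.
Proof. by move=> fg [p hp pe]; exists p => // x; rewrite -fg. Qed.

Lemma deg_le_approx D f : deg_le D f -> poly_approx D 0 f.
Proof.
move/deg_le_hull => hf; eexists; first exact: hf.
by move=> x; rewrite subrr normr0.
Qed.

Lemma approx_neg D (e : R) f :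
  poly_approx D e f -> poly_approx D e (fun x => ~~ f x).
Proof.
case=> p hp pe; exists (fun x => 1 - p x); first exact: hull_neg.
move=> x; have := pe x; rewrite !ler_norml.
by case: (f x) => /= h; apply/andP; split; lra.
Qed.

Lemma approx_xor D (e e' : R) f g : poly_approx D e f -> poly_approx D e' g ->
  poly_approx D (e + e') (fun x => f x (+) g x).
Proof.
case=> p hp pe [q hq qe].
exists (fun x => p x + q x - 2 * p x * q x); first exact: hull_xor.
move=> x; have := pe x; have := qe x.
have := hull_le1 x hp; have := hull_le1 x hq.
have := hull_ge0 x hp; have := hull_ge0 x hq.
rewrite !ler_norml.
move: (p x) (q x) => a b b0 a0 b1 a1 /andP[b2 b3] /andP[a2 a3].
move: b2 b3 a2 a3.
by case: (f x); case: (g x) => /= *; apply/andP; split; nra.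
Qed.

(** Majority vote of [m.*2.+1] independent copies: the tail bound 2^(2m+1) / 8^(m+1) is below 1 /
    2^(m+1). *)
Lemma approx_amplify D f m : poly_approx D (1 / 8) f ->
  poly_approx (m.*2.+1 * D) ((1 / 2) ^+ m.+1) f.
Proof.
case=> p hp pe.
exists (fun x => threshold_prob (p x) m.*2.+1 m.+1).
  exact: hull_threshold.
have powers : 2 ^+ m.*2.+1 * (1 / 8) ^+ m.+1 <= (1 / 2) ^+ m.+1 :> R.
  elim: m => [|m IH]; first by rewrite !expr1; lra.
  rewrite doubleS exprS exprS [(1 / 8) ^+ _]exprS [(1 / 2) ^+ _]exprS; nra.
move=> x; have := pe x; rewrite ler_norml => /andP[].
have p01 : 0 <= p x <= 1 by rewrite (hull_ge0 x hp) (hull_le1 x hp).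
have := threshold_prob_itv m.*2.+1 m.+1 p01.
have := @threshold_prob_low (p x) (1 / 8) m.*2.+1 m.+1 p01.
have := @threshold_prob_high (p x) (1 / 8) m.*2.+1 m.+1 p01.
have -> : (m.*2.+2 - m.+1 = m.+1)%N by lia.
have -> : (m.+1 <= m.*2.+2)%N by lia.
rewrite ler_norml; move: (threshold_prob _ _ _) => t high low /andP[t0 t1].
case: (f x) => /= h1 h2.
  have /high : 1 - p x <= 1 / 8 by lra.
  by move=> /(_ isT) ?; apply/andP; split; lra.
have /low : p x <= 1 / 8 by lra.
by move=> ?; apply/andP; split; lra.
Qed.

(** * Gates of unbounded fan-in *)

Section Lists.
Variables (T : Type) (P : pred T) (ev : T -> cube N -> bool) (err : T -> R).
Variable D : nat.
Hypothesis ev_approx : forall t, P t -> poly_approx D (err t) (ev t).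

Lemma approx_xor_list ts : all P ts ->
  poly_approx D (\sum_(t <- ts) err t)
    (fun x => foldr addb false (map (ev^~ x) ts)).
Proof.
elim: ts => [|t ts IH] /=.
  rewrite big_nil => _.
  exact: deg_le_approx (deg_leW (leq0n D) (deg_le_const _ false)).
by case/andP=> /ev_approx ht /IH hts; rewrite big_cons; exact: approx_xor.
Qed.

(* Razborov's random parity: [q] is the value of the sum of the [ev t] over a
   random sublist, so that [1 - 2 * q] is the product of the [1 - p t]. *)
Lemma random_subsum ts : all P ts -> exists2 q, hull D q & forall x,
  let s := 1 - 2 * q x in let e := \sum_(t <- ts) err t in
  [/\ 0 <= s <= 1, 0 <= e & if has (ev^~ x) ts then s <= e else 1 - e <= s].
Proof.
elim: ts => [|t ts IH] /=.
  move=> _; exists (fun=> 0); first exact: hull_const false.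
  by move=> x; rewrite big_nil mulr0 !subr0 ler01 lexx.
case/andP=> /ev_approx [p hp pe] /IH [q hq qe].
(* The head joins the sublist with probability one half. *)
exists (fun x => (q x + (p x + q x - 2 * p x * q x)) / 2).
  by apply: hull_mean => //; exact: hull_xor.
move=> x; have := hull_ge0 x hp; have := hull_le1 x hp.
have := pe x; have := qe x => /=; rewrite big_cons.
set s := 1 - 2 * q x; set e := \sum_(_ <- _) _ => -[/andP[s0 s1] e0 se].
rewrite ler_norml => /andP[pe1 pe2] p1 p0.
have -> : 1 - 2 * ((q x + (p x + q x - 2 * p x * q x)) / 2) = (1 - p x) * s.
  by rewrite /s; field.
split; first by apply/andP; split; nra.
  by move: pe1 pe2; case: (ev t x) => /=; lra.
move: pe1 pe2; case: (ev t x) => /= pe1 pe2; first by nra.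
by case: ifP se => _ se; nra.
Qed.

(** Take the OR of four independent random parities. If some input is true, each is 0 with
    probability at most 17/32, whose fourth power is below 1/8; if none is, each is 1 with
    probability at most 1/32. *)
Lemma approx_has ts : all P ts -> \sum_(t <- ts) err t <= 1 / 16 ->
  poly_approx (4 * D) (1 / 8) (fun x => has (ev^~ x) ts).
Proof.
move=> Pts e16; have [q hq qe] := random_subsum Pts.
pose r x := 1 - q x.
have hr : hull D r by exact: hull_neg.
exists (fun x => 1 - r x * r x * (r x * r x)).
  apply: hull_neg; have -> : (4 * D = (D + D) + (D + D))%N by lia.
  by do 2![apply: hull_and].
move=> x; have := qe x => /=; set e := \sum_(_ <- _) _ in e16 *.
case; rewrite /r; set q' := q x => /andP[q0 q1] e0 hs.
rewrite ler_norml; case: ifP hs => _ hs /=.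
  have rr : 0 <= (1 - q') * (1 - q') <= 1 / 3 by apply/andP; split; nra.
  by apply/andP; split; nra.
have rr : 1 - e <= (1 - q') * (1 - q') <= 1 by apply/andP; split; nra.
by apply/andP; split; nra.
Qed.

End Lists.

End Hull.

(** * Formulas *)

Lemma all_leq_sumn (T : Type) (w : T -> nat) (s : seq T) n :
  (sumn (map w s) <= n)%N -> all (fun t => (w t <= n)%N) s.
Proof.
elim: s => //= t s IH h; rewrite IH ?andbT ?(leq_trans _ h) ?leq_addr //.
by rewrite leq_addl.
Qed.

Lemma all_leq_foldr_maxn (T : Type) (w : T -> nat) (s : seq T) n :
  (foldr maxn 0 (map w s) <= n)%N -> all (fun t => (w t <= n)%N) s.
Proof. by elim: s => //= t s IH; rewrite geq_max => /andP[-> /IH]. Qed.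

Section Formulas.
Variables (R : realType) (N : nat).
Implicit Types (F : formula N) (Fs : seq (formula N)).

Lemma fsize_gt0 F : (0 < fsize F)%N.
Proof. by case: F. Qed.

Lemma deg_le_all_list (T : Type) (P : pred T) (ev : T -> cube N -> bool)
    (w : T -> nat) ts :
  (forall t, P t -> deg_le (w t) (ev t)) -> all P ts ->
  deg_le (sumn (map w ts)) (fun x => all (ev^~ x) ts).
Proof.
move=> h; elim: ts => [|t ts IH] /=; first by move=> _; exact: deg_le_const.
by case/andP=> /h ht /IH; exact: deg_le_andb.
Qed.

(** Degrees add under products just as sizes do. This exact representation yields a crude size bound
    of order 1/delta, whatever the depth. *)
Lemma deg_le_feval F : deg_le (fsize F) (feval F).
Proof.
have [n] := ubnP (fsize F); elim: n F => // n IH F; rewrite ltnS.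
have children Fs : (sumn (map (@fsize N) Fs) < n)%N ->
    all (fun G => (fsize G < n)%N) Fs.
  case: n {IH} => // n; exact: all_leq_sumn.
case: F => [i|F|Fs|Fs|Fs] /=.
- by move=> _; exact: deg_le_var.
- move=> hF; have dF := IH F hF; exact: deg_leW (leqnSn _) (deg_le_negb dF).
- move=> /children hFs; apply: deg_leW (leqnSn _) _.
  exact: deg_le_all_list IH hFs.
- move=> /children hFs; apply: deg_leW (leqnSn _) _.
  have dN (G : formula N) :
      (fsize G < n)%N -> deg_le (fsize G) (fun x => ~~ feval G x).
    by move=> hG; exact: deg_le_negb (IH G hG).
  apply: deg_le_eq (deg_le_negb (deg_le_all_list dN hFs)) => x.
  by rewrite -has_predC; apply: eq_has => G /=; rewrite negbK.
- move=> /children hFs; apply: deg_leW (leqnSn _) _.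
  elim: Fs hFs => [|G Fs IHs] /=; first by move=> _; exact: deg_le_const.
  case/andP=> hG /IHs dFs; have dG := IH G hG; apply: deg_le_addb.
    exact: deg_leW (leq_addr _ _) dG.
  exact: deg_leW (leq_addl _ _) dFs.
Qed.

Lemma deg_le_depth0 F : fdepth F = 0%N -> deg_le 1 (feval F).
Proof.
elim: F => [i|F IH|||] //= => [_|/IH]; [exact: deg_le_var|exact: deg_le_negb].
Qed.

Lemma one_plus_ln_le_powR (a y : R) : 1 <= a -> 1 <= y ->
  1 + ln y <= a * y `^ a^-1.
Proof.
move=> a1 y1; have a0 : 0 < a by lra.
have y0 : 0 < y by lra.
have -> : y `^ a^-1 = expR (a^-1 * ln y) by rewrite /powR gt_eqF.
have := expR_ge1Dx (a^-1 * ln y); rewrite -(ler_pM2l a0) mulrDr mulr1 mulrA.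
by rewrite mulfV ?gt_eqF // mul1r; lra.
Qed.

(** A rational substitute for [1 / 2 <= ln 2]. *)
Lemma expR_half_le2 : expR (1 / 2) <= 2 :> R.
Proof.
have := expR_ge1Dx (- (1 / 2) : R); rewrite expRN => h.
have e0 := expR_gt0 (1 / 2 : R).
have : 1 / 2 * expR (1 / 2) <= 1 :> R.
  by rewrite -ler_pdivlMr // [leRHS]div1r; lra.
lra.
Qed.

(** The number of copies with which a majority vote reaches error 1 / (16 y). *)
Lemma exists_log2 (y : R) : 1 <= y -> exists m,
  (1 / 2) ^+ m.+1 <= y^-1 / 16 /\ m.*2.+1%:R <= 9 * (1 + ln y).
Proof.
move=> y1; have y0 : 0 < y by lra.
have ly : 0 <= 2 * ln y by rewrite mulr_ge0 // ln_ge0.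
have /andP[t1 t2] := truncn_itv ly; set t := Num.truncn _ in t1 t2.
(* Here [t] is the integer part of [2 * ln y], so [2 ^+ t.+1] exceeds [y], and four further halvings
   supply the 16. *)
exists t.+4; split.
  have yt : y <= 2 ^+ t.+1.
    rewrite -[leLHS]lnK //; apply: (@le_trans _ _ (expR (t.+1%:R * (1 / 2)))).
      by rewrite ler_expR; lra.
    rewrite mulrC expRM_natr; apply: lerXn2r; rewrite ?nnegrE ?expR_ge0 //.
    exact: expR_half_le2.
  have -> : (1 / 2) ^+ t.+4.+1 = (2 ^+ t.+1)^-1 / 16 :> R.
    rewrite div1r exprVn -(addn4 t.+1) exprD invfM.
    by congr (_ * _^-1); ring.
  by rewrite ler_pM2r ?invr_gt0 // lef_pV2 ?posrE // exprn_gt0.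
have -> : t.+4.*2.+1%:R = 2 * t%:R + 9 :> R.
  have -> : t.+4.*2.+1 = (2 * t + 9)%N by lia.
  by rewrite natrD natrM.
lra.
Qed.

Section Approximation.
Variable a : R.
Hypothesis a_ge1 : 1 <= a.

(** The base 36 is 4 * 9: four parities per gate, and the 9 of [exists_log2]. *)
Let bound d (s : nat) : R := 36 ^+ d.+1 * a ^+ d * s%:R `^ a^-1.

Let bound_ge d s : (0 < s)%N -> 36 <= bound d s.
Proof.
move=> s0; have s1 : 1 <= s%:R `^ a^-1.
  by rewrite -[leLHS](powRr0 s%:R) ler_powR ?ler1n // invr_ge0 (le_trans ler01).
have A1 : 1 <= a ^+ d by exact: exprn_ege1.
have B1 : 1 <= 36 ^+ d :> R by apply: exprn_ege1; lra.
rewrite /bound exprS -!mulrA ler_peMr // ?ler0n //.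
by rewrite mulr_ege1 // mulr_ege1.
Qed.

(** Inside a gate of size [s] a child may err in proportion to its share of the size, so all
    children together err at most 1/16. The quarter leaves room for the factor 4 of [approx_has]. *)
Let child d F s :
  ((0 < d)%N -> forall G : formula N, (fdepth G <= d)%N ->
     exists2 D, poly_approx D (1 / 8 : R) (feval G) &
       D%:R <= bound d.-1 (fsize G)) ->
  (fsize F <= s)%N -> (fdepth F <= d)%N ->
  poly_approx (Num.truncn (bound d s / 4))
    ((fsize F)%:R / (16 * s%:R) : R) (feval F).
Proof.
move=> IH Fs Fd; have F0 := fsize_gt0 F; have s0 := leq_trans F0 Fs.
have F0R : 0 < (fsize F)%:R :> R by rewrite ltr0n.
have s0R : 0 < s%:R :> R by rewrite ltr0n.
have b4 : 0 <= bound d s / 4 by have := bound_ge d s0; lra.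
case: d IH Fd b4 => [_|d IH] Fd b4.
  have e0 : 0 <= (fsize F)%:R / (16 * s%:R) :> R.
    by rewrite divr_ge0 ?mulr_ge0 // ltW.
  apply: approxW e0 (deg_le_approx R (deg_le_depth0 _)).
    by rewrite truncn_ge_nat //; have := bound_ge 0 s0; lra.
  by apply/eqP; rewrite -leqn0.
have [D0 /approx_amplify apx D0b] := IH isT F Fd.
pose y : R := s%:R / (fsize F)%:R.
have y1 : 1 <= y by rewrite ler_pdivlMr // mul1r ler_nat.
have [m [em dm]] := exists_log2 y1.
apply: approxW (apx m).
  rewrite truncn_ge_nat // natrM.
  have step := one_plus_ln_le_powR a_ge1 y1.
  (* The factor in [y] pays for the amplification, the other one belongs to the bound for the
     child. *)
  have sE : s%:R `^ a^-1 = y `^ a^-1 * (fsize F)%:R `^ a^-1.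
    rewrite -powRM ?ltW //; first by rewrite /y divfK // gt_eqF.
    by rewrite /y divr_gt0.
  have p0 := powR_ge0 (fsize F)%:R a^-1.
  apply: le_trans (ler_pM _ _ dm D0b) _; rewrite ?ler0n //.
  rewrite /bound /= sE ler_pdivlMr // ![36 ^+ d.+2]exprS ![a ^+ d.+1]exprS.
  set A := 36 ^+ _; set B := a ^+ d.
  set z := _ `^ _ in p0 *; set v := y `^ _ in step *.
  have -> : 9 * (1 + ln y) * (A * B * z) * 4 =
      (1 + ln y) * (36 * A * B * z) by ring.
  have -> : 36 * A * (a * B) * (v * z) = a * v * (36 * A * B * z) by ring.
  by rewrite ler_wpM2r // !mulr_ge0 ?exprn_ge0 ?ler0n // (le_trans ler01).
apply: le_trans em _; rewrite /y invf_div invfM mulrA mulrAC.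
by rewrite -mulrA [X in _ * X]mulrC mulrA.
Qed.

Let approx_gate d : (forall s (G : formula N),
    (fdepth G <= d)%N && (fsize G <= s)%N ->
    poly_approx (Num.truncn (bound d s / 4))
      ((fsize G)%:R / (16 * s%:R) : R) (feval G)) ->
  forall F, (fdepth F <= d.+1)%N ->
  exists2 D, poly_approx D (1 / 8 : R) (feval F) & D%:R <= bound d (fsize F).
Proof.
move=> ch.
have gate (Gs : seq (formula N)) (s := (sumn (map (@fsize N) Gs)).+1)
    (P := fun G : formula N => (fdepth G <= d)%N && (fsize G <= s)%N)
    (err := fun G : formula N => (fsize G)%:R / (16 * s%:R) : R) :
    (foldr maxn 0 (map (@fdepth N) Gs) <= d)%N ->
    all P Gs /\ \sum_(G <- Gs) err G <= 1 / 16.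
  move=> /all_leq_foldr_maxn hd; split.
    rewrite all_predI hd; exact: all_leq_sumn (leqnSn _).
  have -> : \sum_(G <- Gs) err G =
      (sumn (map (@fsize N) Gs))%:R / (16 * s%:R).
    by rewrite -mulr_suml sumnE big_map natr_sum.
  rewrite ler_pdivrMr ?mulr_gt0 ?ltr0n //.
  have : (sumn (map (@fsize N) Gs))%:R <= s%:R :> R by rewrite ler_nat.
  lra.
have deg4 (s : nat) : (0 < s)%N ->
    (4 * Num.truncn (bound d s / 4))%:R <= bound d s.
  move=> s0; have b0 : 0 <= bound d s / 4 by have := bound_ge d s0; lra.
  by have /andP[h _] := truncn_itv b0; rewrite natrM; lra.
(* Structural induction serves the NOT gates, which keep the depth; the other gates rely on [ch]. *)
elim=> [i|G IH|Gs|Gs|Gs] /=.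
- move=> _; exists 1%N; last by have := bound_ge d (isT : (0 < 1)%N); lra.
  by apply: approxW (deg_le_approx R (deg_le_var i)) => //; lra.
- move=> /IH [D hD Db]; exists D; first exact: approx_neg.
  apply: le_trans Db _; rewrite /bound ler_wpM2l ?mulr_ge0 ?exprn_ge0 //.
    exact: le_trans ler01 _.
  by rewrite ge0_ler_powR ?nnegrE ?ler_nat // invr_ge0 (le_trans ler01).
(* AND reduces to OR by De Morgan. *)
- move=> /gate [hP herr]; eexists; last exact: deg4.
  have ch' := approx_has (fun G hG => approx_neg (ch _ G hG)) hP herr.
  apply: approx_eq (approx_neg ch') => x.
  by rewrite (has_predC (fun G => feval G x)) negbK.
- move=> /gate [hP herr]; eexists; last exact: deg4.
  by apply: approx_eq (approx_has (fun G hG => ch _ G hG) hP herr).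
- move=> /gate [hP herr]; eexists; last exact: deg4.
  have ch' := approx_xor_list (fun G hG => ch _ G hG) hP.
  apply: approx_eq (approxW _ _ ch') => //; first exact: leq_pmull.
  by apply: le_trans herr _; lra.
Qed.

(* The degree grows by [O(1 + ln (s / s'))] from a subformula of size [s'] to
   its parent of size [s]; since [1 + ln y <= a * y `^ a^-1], the product of
   these factors along a path telescopes. *)
Lemma formula_approx d F : (fdepth F <= d.+1)%N ->
  exists2 D, poly_approx D (1 / 8 : R) (feval F) & D%:R <= bound d (fsize F).
Proof.
elim: d F => [|d IHd] F; apply: approx_gate => s G /andP[Gd Gs].
  by apply: child.
by apply: child => // _; exact: IHd.
Qed.

End Approximation.
End Formulas.

(** * The size lower bound *)

Section LowerBound.
Variables (R : realType) (N : nat).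
Implicit Types (g : cube N -> bool) (F : formula N) (delta alpha : R).

Lemma sum_coin_weight alpha : \sum_(x : cube N) coin_weight alpha x = 1.
Proof.
rewrite /coin_weight.
rewrite -(bigA_distr_bigA (fun _ (b : bool) => if b then alpha else 1 - alpha)).
rewrite big1 // => i _.
by rewrite (bigD1 true) //= (bigD1 false) //= big1 => [|[]//]; ring.
Qed.

Lemma coin_weight_ge0 alpha (x : cube N) :
  0 <= alpha <= 1 -> 0 <= coin_weight alpha x.
Proof.
by case/andP=> a0 a1; apply: prodr_ge0 => i _; case: (x i); rewrite ?subr_ge0.
Qed.

Lemma coin_prob_approx alpha g (p : cube N -> R) (e : R) : 0 <= alpha <= 1 ->
  (forall x, `|p x - (g x)%:R| <= e) ->
  `|\sum_x coin_weight alpha x * p x - coin_prob alpha g| <= e.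
Proof.
move=> a01 pe.
have -> : coin_prob alpha g = \sum_x coin_weight alpha x * (g x)%:R.
  rewrite /coin_prob big_mkcond; apply: eq_bigr => x _.
  by case: (g x); rewrite ?mulr1 ?mulr0.
rewrite -sumrB (le_trans (ler_norm_sum _ _ _)) //.
rewrite -[leRHS]mul1r -[X in _ <= X * _](sum_coin_weight alpha) mulr_suml.
apply: ler_sum => x _; rewrite -mulrBr normrM ger0_norm ?coin_weight_ge0 //.
by rewrite ler_wpM2l // coin_weight_ge0.
Qed.

(** The gap bound is linear in the function, so it passes to the hull. There the gap is at least 0.8
    - 2/8, which exceeds 1/2, while [1 - delta] is at least 1/2. *)
Lemma approx_coin_degree D g delta : 0 < delta -> delta <= 1 / 2 ->
  solves_coin delta g -> poly_approx D (1 / 8 : R) g ->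
  1 / delta <= 16 * D%:R.
Proof.
move=> d0 d2 [g0 g1] [p hp pe].
have d1 : delta < 1 by lra.
have := hp _ _ (fun f df => low_degree_coin_gap d0 d1 df).
have a0 : 0 <= (1 - delta) / 2 <= 1 by apply/andP; split; lra.
have a1 : 0 <= (1 + delta) / 2 <= 1 by apply/andP; split; lra.
have := coin_prob_approx a0 pe; have := coin_prob_approx a1 pe.
under [X in _ -> _ -> X <= _ -> _]eq_bigr do rewrite mulrBl.
rewrite sumrB !ler_norml => /andP[h1 _] /andP[_ h2] h3.
have : 1 / 2 <= 4 * D%:R * delta / (1 - delta) by lra.
rewrite ler_pdivlMr ?subr_gt0 // ler_pdivrMr // => h.
lra.
Qed.

Lemma formula_coin_size delta g F : 0 < delta -> delta <= 1 / 2 ->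
  solves_coin delta g -> computes F g -> 1 / delta <= 16 * (fsize F)%:R.
Proof.
move=> d0 d2 sg cF; apply: approx_coin_degree d0 d2 sg _.
have e8 : 0 <= 1 / 8 :> R by lra.
exact: approx_eq cF (approxW (leqnn _) e8 (deg_le_approx R (deg_le_feval F))).
Qed.

(** With [a] equal to 1 + ln s / k, the factor s^(1/a) is at most e^k, hence at most 4^k, and a k-th
    root can be taken. The constants are 576 = 16 * 36 and 144 = 36 * 4. *)
Lemma formula_coin_root delta k g F :
  0 < delta -> delta <= 1 / 2 -> (0 < k)%N -> (fdepth F <= k.+1)%N ->
  solves_coin delta g -> computes F g ->
  (1 / delta) `^ (1 / k%:R) <= 576 * 144 * (1 + ln (fsize F)%:R / k%:R).
Proof.
move=> d0 d2 k0 Fd sg cF; set L := ln _; set a := 1 + _.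
have s1 : 1 <= (fsize F)%:R :> R by rewrite ler1n fsize_gt0.
have s0 : 0 < (fsize F)%:R :> R by lra.
have L0 : 0 <= L by exact: ln_ge0.
have k0R : 0 < k%:R :> R by rewrite ltr0n.
have a1 : 1 <= a by rewrite /a lerDl divr_ge0 // ltW.
have [D hD Db] := formula_approx a1 Fd.
have Dlow := approx_coin_degree d0 d2 sg (approx_eq cF hD).
have root : (fsize F)%:R `^ a^-1 <= 4 ^+ k.
  have -> : (fsize F)%:R `^ a^-1 = expR (a^-1 * L) by rewrite /powR gt_eqF.
  apply: (@le_trans _ _ (expR k%:R)).
    rewrite ler_expR mulrC ler_pdivrMr; last by lra.
    by rewrite /a mulrDr mulr1 mulrC divfK ?gt_eqF // lerDr ltW.
  have -> : k%:R = (1 / 2) * (2 * k)%:R :> R by rewrite natrM; field.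
  rewrite expRM_natr (exprM _ 2%N).
  apply: lerXn2r; rewrite ?nnegrE ?exprn_ge0 ?expR_ge0 //.
  have := expR_half_le2 R; have := expR_ge0 (1 / 2 : R) => e0 e2.
  by rewrite expr2; nra.
have up : 1 / delta <= (576 * 144 * a) ^+ k.
  apply: le_trans Dlow _.
  apply: (@le_trans _ _ (16 * (36 ^+ k.+1 * a ^+ k * 4 ^+ k))).
    rewrite ler_wpM2l //; apply: le_trans Db _.
    by rewrite ler_wpM2l // mulr_ge0 ?exprn_ge0 //; lra.
  have -> : 576 * 144 * a = 576 * (36 * a * 4) by ring.
  rewrite exprS [leRHS]exprMn [in leRHS]exprMn [in leRHS]exprMn.
  have -> : 16 * (36 * 36 ^+ k * a ^+ k * 4 ^+ k) =
      576 * (36 ^+ k * a ^+ k * 4 ^+ k) by ring.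
  rewrite ler_wpM2r ?mulr_ge0 ?exprn_ge0 //; first by lra.
  by rewrite -[leLHS]expr1 ler_weXn2l //; lra.
have b0 : 0 <= 576 * 144 * a by lra.
have -> : 576 * 144 * a = ((576 * 144 * a) ^+ k) `^ (1 / k%:R).
  by rewrite -powR_mulrn // -powRrM div1r mulfV ?powRr1 // gt_eqF.
by rewrite ge0_ler_powR ?nnegrE ?divr_ge0 ?exprn_ge0 // ltW.
Qed.

End LowerBound.

(* MathComp + MathComp-Analysis. The hidden constant of the Omega is c; it
   depends only on the constant C of the regime d = O(1 + log(1/delta)),
   outside of which no positive constant c works. *)
Theorem theorem2p3 (R : realType) :
  forall C : R, exists c : R, 0 < c /\
    forall (delta : R) (d N : nat) (g : cube N -> bool) (F : formula N),
      0 < delta -> delta < 1 ->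
      (2 <= d)%N -> (1 <= N)%N ->
      d%:R <= C * (1 + ln (1 / delta)) ->
      solves_coin delta g ->
      (fdepth F <= d)%N -> (1 < fsize F)%N ->
      computes F g ->
      expR (c * (d%:R * (1 / delta) `^ (1 / (d.-1)%:R))) <= (fsize F)%:R.
Proof.
move=> C; pose M : R := 576 * 144 * (35 * `|C| + 2).
have C0 : 0 <= `|C| by [].
have M0 : 0 < M by rewrite /M; lra.
exists M^-1; split; first by rewrite invr_gt0.
move=> delta d N g F d0 d1 d2 _ dC sg Fd Fs cF.
have s2 : 2 <= (fsize F)%:R :> R by rewrite ler_nat.
have s0 : 0 < (fsize F)%:R :> R by lra.
set u := _ `^ _; set L := ln (fsize F)%:R : R.
(* Size at least 2 keeps [L] away from 0, so additive constants can be absorbed into multiples of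
   [L]. *)
have L2 : 1 / 2 <= L.
  by rewrite -ler_expR lnK ?posrE //; have := expR_half_le2 R; lra.
suff duL : d%:R * u <= M * L.
  by rewrite -[leRHS]lnK ?posrE // ler_expR ler_pdivrMl.
have dinv : 1 <= 1 / delta by rewrite ler_pdivlMr // mul1r ltW.
have lnd : 0 <= ln (1 / delta) by exact: ln_ge0.
have {}dC : d%:R <= `|C| * (1 + ln (1 / delta)).
  by apply: le_trans dC _; rewrite ler_wpM2r ?ler_norm //; lra.
case: d d2 dC Fd @u => [|[|k]] // _ dC Fd u.
have k0 : 0 < k.+1%:R :> R by rewrite ltr0n.
have k1 : 1 <= k.+1%:R :> R by rewrite ler1n.
have kd : k.+2%:R = k.+1%:R + 1 :> R by rewrite -natr1.
(* The degree bound is applied for [delta] at most 1/2; otherwise [u] and [ln (1 / delta)] are both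
   at most 2, and so [d] is bounded in terms of [C]. *)
have [small|large] := leP delta (1 / 2).
  have size := formula_coin_size d0 small sg cF.
  have uL : u <= 576 * 144 * (1 + L / k.+1%:R).
    exact: formula_coin_root d0 small _ Fd sg cF.
  have lnL : ln (1 / delta) <= 16 + L.
    have : ln (1 / delta) <= ln (16 * (fsize F)%:R).
      have l0 : 0 < 1 / delta by lra.
      have r0 : 0 < 16 * (fsize F)%:R :> R by lra.
      by rewrite ler_ln.
    rewrite lnM ?posrE // -/L.
    by have := @ln_sublinear R 16 (ltr0Sn R 15); lra.
  (* The crude bound turns the restriction on [d] into d <= |C| (17 + L), and 17 is at most 34 L. *)
  have dL : k.+2%:R <= 35 * `|C| * L.
    apply: le_trans dC _; rewrite [35 * _]mulrC -mulrA ler_wpM2l //; lra.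
  apply: (@le_trans _ _ (k.+2%:R * (576 * 144 * (1 + L / k.+1%:R)))).
    by rewrite ler_wpM2l.
  have Lk : k.+2%:R * (L / k.+1%:R) <= 2 * L.
    by rewrite mulrA ler_pdivrMr // kd; nra.
  have K0 : 0 <= 576 * 144 :> R by exact: mulr_ge0 (ler0n _ _) (ler0n _ _).
  rewrite [leLHS]mulrCA /M -[leRHS]mulrA (ler_wpM2l K0) //.
  by rewrite [leLHS]mulrDr mulr1 [leRHS]mulrDl lerD.
have dinv2 : 1 / delta <= 2 by rewrite ler_pdivrMr //; lra.
have u2 : u <= 2.
  apply: le_trans dinv2; rewrite -[leRHS]powRr1; last by lra.
  by rewrite ler_powR // ler_pdivrMr // mul1r.
have lnd2 : ln (1 / delta) <= 2.
  by apply/ltW/(lt_le_trans (ln_sublinear _)); rewrite // divr_gt0.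
have u0 : 0 <= u by exact: powR_ge0.
have dL : k.+2%:R <= 6 * `|C| * L.
  by apply: le_trans dC _; nra.
apply: (@le_trans _ _ (6 * `|C| * L * 2)); first by rewrite ler_pM // ler0n.
have CL : 0 <= `|C| * L by rewrite mulr_ge0 //; lra.
rewrite /M; lra.
Qed.
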